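(* Let $f\dashv u$ be an adjunction of quasi-categories, with $u\colon A\to B$ and $f\colon B\to A$. Then for any simplicial set $X$ and any quasi-category $C$, $f^X\dashv u^X$ (with $u^X\colon A^X\to B^X$ the right adjoint of $f^X\colon B^X\to A^X$) and $C^u\dashv C^f$ (with $C^f\colon C^A\to C^B$ the right adjoint of $C^u\colon C^B\to C^A$) are adjunctions of quasi-categories.
   Context: A quasi-category is a simplicial set with fillers for all inner horns; functors are simplicial maps between quasi-categories. For a quasi-category $A$ and a simplicial set $X$ the internal hom $A^X$ is a quasi-category. $\mathrm{qCat}_2$ is the strict 2-category of quasi-categories with hom-categories $\hom'(A,B)=h(B^A)$, where $h\colon\mathrm{sSet}\to\mathrm{Cat}$ is left adjoint to the nerve. An adjunction of quasi-categories is an adjunction in $\mathrm{qCat}_2$ (1-cells with unit and counit 2-cells satisfying the triangle identities). *)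

(* Defs.v *)
From mathcomp Require Import all_boot generic_quotient.
From mathcomp Require Import boolp.

Set Implicit Arguments.
Unset Strict Implicit.
Unset Printing Implicit Defensive.

Local Open Scope quotient_scope.
Local Open Scope nat_scope.

(* [simp m n] is the set of arrows [m] -> [n] of the simplex category, with
   [n] = {0 < ... < n} = 'I_n.+1. *)
Record simp (m n : nat) := Simp {
  simp_fun :> 'I_m.+1 -> 'I_n.+1;
  simp_mono : {homo simp_fun : i j / i <= j} }.

Definition simp_id n : simp n n := @Simp n n id (fun _ _ le_ij => le_ij).

Definition simp_comp l m n (b : simp m n) (a : simp l m) : simp l n :=
  @Simp l n (fun i => b (a i))
    (fun i j le_ij => simp_mono b (simp_mono a le_ij)).

Lemma simp_ext m n (a b : simp m n) : a =1 b -> a = b.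
Proof.
case: a b => [a ma] [b mb] /= /funext eab; case: _ / eab mb => mb.
by congr Simp; exact: Prop_irrelevance.
Qed.

Record sSet := SSet {
  simplex :> nat -> Type;
  act : forall m n, simp m n -> simplex n -> simplex m;
  act_id : forall n (x : simplex n), act (simp_id n) x = x;
  act_comp : forall l m n (b : simp m n) (a : simp l m) (x : simplex n),
    act (simp_comp b a) x = act a (act b x) }.

Record sMap (X Y : sSet) := SMap {
  smap_fun :> forall n, X n -> Y n;
  smap_nat : forall m n (a : simp m n) (x : X n),
    smap_fun (act a x) = act a (smap_fun x) }.

Lemma smap_ext (X Y : sSet) (f g : sMap X Y) :
  (forall n (x : X n), f n x = g n x) -> f = g.
Proof.
case: f g => [f nf] [g ng] /= fg.
have efg : f = g.
  by apply: functional_extensionality_dep => n; apply/funext => x; exact: fg.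
by case: _ / efg ng => ng; congr SMap; exact: Prop_irrelevance.
Qed.

Definition sid (X : sSet) : sMap X X :=
  @SMap X X (fun _ x => x) (fun _ _ _ _ => erefl).

Definition scomp (X Y Z : sSet) (g : sMap Y Z) (f : sMap X Y) : sMap X Z.
Proof.
exists (fun n x => g n (f n x)).
by move=> m n a x; rewrite !smap_nat.
Defined.

Lemma scompA (X Y Z W : sSet) (h : sMap Z W) (g : sMap Y Z) (f : sMap X Y) :
  scomp h (scomp g f) = scomp (scomp h g) f.
Proof. exact: smap_ext. Qed.

Lemma scompIs (X Y : sSet) (f : sMap X Y) : scomp (sid Y) f = f.
Proof. exact: smap_ext. Qed.

Lemma scompsI (X Y : sSet) (f : sMap X Y) : scomp f (sid X) = f.
Proof. exact: smap_ext. Qed.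

Definition Delta (n : nat) : sSet.
Proof.
exists (fun m => simp m n) (fun l m a x => simp_comp x a).
- by move=> m x; apply: simp_ext.
- by move=> k l m b a x; apply: simp_ext.
Defined.

Definition Delta_map m n (a : simp m n) : sMap (Delta m) (Delta n).
Proof.
exists (fun l (x : simp l m) => simp_comp a x).
by move=> k l b x; apply: simp_ext.
Defined.

(* A simplex of Delta n lies in the horn at k when it lies in the i-th face,
   i.e. avoids the vertex i, for some i different from k. *)
Definition in_horn n (k : 'I_n.+1) m (x : simp m n) : Prop :=
  exists2 i : 'I_n.+1, i != k & forall j, x j != i.

Lemma in_horn_act n (k : 'I_n.+1) l m (a : simp l m) (x : simp m n) :
  in_horn k x -> in_horn k (simp_comp x a).
Proof. by case=> i ik xi; exists i => // j; exact: xi. Qed.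

Definition horn n (k : 'I_n.+1) : sSet.
Proof.
exists (fun m => {x : simp m n | in_horn k x})
       (fun l m a x => exist _ (simp_comp (sval x) a)
                             (in_horn_act a (svalP x))).
- by move=> m [x hx]; apply: eq_exist; exact: simp_ext.
- by move=> j l m b a [x hx]; apply: eq_exist; exact: simp_ext.
Defined.

Definition horn_incl n (k : 'I_n.+1) : sMap (horn k) (Delta n) :=
  @SMap (horn k) (Delta n) (fun _ x => sval x) (fun _ _ _ _ => erefl).

Definition is_qcat (A : sSet) : Prop :=
  forall n (k : 'I_n.+1), 0 < k < n ->
  forall h : sMap (horn k) A,
  exists g : sMap (Delta n) A, scomp g (horn_incl k) = h.

Definition sprod (X Y : sSet) : sSet.
Proof.
exists (fun n => X n * Y n)%type (fun m n a p => (act a p.1, act a p.2)).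
- by move=> n [x y]; rewrite !act_id.
- by move=> l m n b a [x y]; rewrite !act_comp.
Defined.

Definition sprod_map (X X' Y Y' : sSet) (f : sMap X X') (g : sMap Y Y') :
  sMap (sprod X Y) (sprod X' Y').
Proof.
exists (fun n (p : sprod X Y n) => (f n p.1, g n p.2)).
by move=> m n a [x y] /=; rewrite !smap_nat.
Defined.

Definition ssnd (X Y : sSet) : sMap (sprod X Y) Y :=
  @SMap (sprod X Y) Y (fun _ p => p.2) (fun _ _ _ _ => erefl).

(* [sexp A X] is A^X: its n-simplices are the maps Delta n x X -> A. *)
Definition sexp (A X : sSet) : sSet.
Proof.
exists (fun n => sMap (sprod (Delta n) X) A)
       (fun m n a g => scomp g (sprod_map (Delta_map a) (sid X))).
- move=> n g; apply: smap_ext => m [x y] /=.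
  by congr (g _ (_, _)); exact: simp_ext.
- move=> l m n b a g; apply: smap_ext => k [x y] /=.
  by congr (g _ (_, _)); exact: simp_ext.
Defined.

(* f^X : A^X -> B^X *)
Definition sexp_post (A B : sSet) (f : sMap A B) (X : sSet) :
  sMap (sexp A X) (sexp B X).
Proof.
exists (fun n (g : sexp A X n) => scomp f g : sexp B X n).
by move=> m n a g; apply: smap_ext.
Defined.

(* C^f : C^B -> C^A *)
Definition sexp_pre (C : sSet) (A B : sSet) (f : sMap A B) :
  sMap (sexp C B) (sexp C A).
Proof.
exists (fun n (g : sexp C B n) =>
          scomp g (sprod_map (sid (Delta n)) f) : sexp C A n).
by move=> m n a g; apply: smap_ext.
Defined.

(* The vertex of B^A corresponding to f : A -> B. *)
Definition vertex (A B : sSet) (f : sMap A B) : sexp B A 0 :=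
  scomp f (ssnd (Delta 0) A).

Record cat := Cat {
  ob :> Type;
  hom : ob -> ob -> Type;
  idm : forall x, hom x x;
  comp : forall x y z, hom y z -> hom x y -> hom x z;
  comp_idl : forall x y (a : hom x y), comp (idm y) a = a;
  comp_idr : forall x y (a : hom x y), comp a (idm x) = a;
  comp_assoc : forall x y z w (c : hom z w) (b : hom y z) (a : hom x y),
    comp c (comp b a) = comp (comp c b) a }.

Record functor (C D : cat) := Functor {
  fob :> C -> D;
  fhom : forall x y, hom x y -> hom (fob x) (fob y);
  fhom_id : forall x, fhom (idm x) = idm (fob x);
  fhom_comp : forall x y z (b : hom y z) (a : hom x y),
    fhom (comp b a) = comp (fhom b) (fhom a) }.

Definition hom_cast (C : cat) (x x' y y' : C) (ex : x = x') (ey : y = y')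
    (a : hom x y) : hom x' y' :=
  eq_rect y (hom x') (eq_rect x (fun t => hom t y) a x' ex) y' ey.

Definition fcomp (C D E : cat) (G : functor D E) (F : functor C D) :
  functor C E.
Proof.
exists (fun x => G (F x)) (fun x y a => fhom G (fhom F a)).
- by move=> x; rewrite !fhom_id.
- by move=> x y z b a; rewrite !fhom_comp.
Defined.

Lemma hom_cast_id (C : cat) (x y : C) (ex : x = x) (ey : y = y)
  (a : hom x y) : hom_cast ex ey a = a.
Proof.
by rewrite (Prop_irrelevance ex erefl) (Prop_irrelevance ey erefl).
Qed.

Lemma functor_ext (C D : cat) (F G : functor C D) (e : forall x, F x = G x) :
  (forall x y (a : hom x y), hom_cast (e x) (e y) (fhom F a) = fhom G a) ->
  F = G.
Proof.
case: F G e => [F Fh Fi Fc] [G Gh Gi Gc] /= e.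
have eFG : F = G by apply/funext.
case: _ / eFG Gh Gi Gc e => Gh Gi Gc e eh.
have eFGh : Fh = Gh.
  apply: functional_extensionality_dep => x.
  apply: functional_extensionality_dep => y.
  by apply: funext => a; rewrite -eh hom_cast_id.
case: _ / eFGh Gi Gc eh => Gi Gc _.
by congr Functor; exact: Prop_irrelevance.
Qed.

Definition ord_cat (n : nat) : cat.
Proof.
exists 'I_n.+1 (fun i j => is_true (i <= j)) (fun i => leqnn i)
  (fun i j k (jk : is_true (j <= k)) (ij : is_true (i <= j)) =>
     leq_trans ij jk).
all: by move=> *; exact: bool_irrelevance.
Defined.

Definition ord_functor m n (a : simp m n) : functor (ord_cat m) (ord_cat n).
Proof.
exists (a : ord_cat m -> ord_cat n)
       (fun (i j : ord_cat m) (ij : hom i j) => simp_mono a ij).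
all: by move=> *; exact: bool_irrelevance.
Defined.

Definition nerve (C : cat) : sSet.
Proof.
exists (fun n => functor (ord_cat n) C)
       (fun m n a F => fcomp F (ord_functor a)).
- move=> n F.
  apply: (@functor_ext _ _ (fcomp F (ord_functor (simp_id n))) F (fun=> erefl)) => i j ij /=.
  by congr (fhom F); exact: bool_irrelevance.
- move=> l m n b a F.
  apply: (@functor_ext _ _ (fcomp F (ord_functor (simp_comp b a)))
    (fcomp (fcomp F (ord_functor b)) (ord_functor a)) (fun=> erefl)) => i j ij /=.
  by congr (fhom F); exact: bool_irrelevance.
Defined.

Definition nerve_map (C D : cat) (F : functor C D) : sMap (nerve C) (nerve D).
Proof.
exists (fun n (G : nerve C n) => fcomp F G : nerve D n).
by move=> m n a G; exact: (@functor_ext _ _ (fcomp F (fcomp G (ord_functor a)))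
  (fcomp (fcomp F G) (ord_functor a)) (fun=> erefl)).
Defined.

Definition coface n (i : 'I_n.+2) : simp n n.+1.
Proof.
exists (lift i) => j k jk; by rewrite leq_bump2.
Defined.

Definition codeg0 : simp 1 0 :=
  @Simp 1 0 (fun=> ord0) (fun _ _ _ => leqnn 0).

Section HomotopyCategory.
Variable X : sSet.

(* d_1 is the source and d_0 the target of a 1-simplex. *)
Definition edge (x y : X 0) : Type :=
  {e : X 1 | act (coface ord_max) e = x /\ act (coface ord0) e = y}.

Inductive path : X 0 -> X 0 -> Type :=
| Pnil x : path x x
| Pcons x y z (e : edge x y) (p : path y z) : path x z.

Fixpoint pcat x y z (p : path x y) : path y z -> path x z :=
  match p in path x y return path y z -> path x z with
  | Pnil _ => fun q => q
  | Pcons _ _ _ e p' => fun q => Pcons e (pcat p' q)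
  end.

Definition pedge x y (e : edge x y) : path x y := Pcons e (Pnil y).

(* The congruence on the free category on the edges generated by
   s_0 x ~ id and d_0 s . d_2 s ~ d_1 s. *)
Inductive path_rel : forall x y, path x y -> path x y -> Prop :=
| PRdeg x (e : edge x x) :
    sval e = act codeg0 x -> path_rel (pedge e) (Pnil x)
| PRtri x y z (a : edge x y) (b : edge y z) (c : edge x z) (s : X 2) :
    act (coface (@Ordinal 3 2 isT)) s = sval a ->
    act (coface (@Ordinal 3 0 isT)) s = sval b ->
    act (coface (@Ordinal 3 1 isT)) s = sval c ->
    path_rel (pcat (pedge a) (pedge b)) (pedge c)
| PRcat x y z (p p' : path x y) (q q' : path y z) :
    path_rel p p' -> path_rel q q' -> path_rel (pcat p q) (pcat p' q')
| PRrefl x y (p : path x y) : path_rel p p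
| PRsym x y (p q : path x y) : path_rel p q -> path_rel q p
| PRtrans x y (p q r : path x y) :
    path_rel p q -> path_rel q r -> path_rel p r.

Definition path_equiv x y : rel {classic path x y} :=
  fun p q => `[< path_rel p q >].

Lemma path_equivP x y : equiv_class_of (@path_equiv x y).
Proof.
split=> [p|p q|q p r].
- by apply/asboolP; exact: PRrefl.
- by apply/asboolP/asboolP; exact: PRsym.
- by move=> /asboolP pq /asboolP qr; apply/asboolP; exact: PRtrans pq qr.
Qed.

Canonical path_equiv_equiv x y := EquivRelPack (@path_equivP x y).

Definition hohom x y : Type := {eq_quot (@path_equiv x y)}.

Definition hoclass x y (p : path x y) : hohom x y :=
  \pi_({eq_quot (@path_equiv x y)})%qT (p : {classic path x y}).

Definition horepr x y (a : hohom x y) : path x y := repr a.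

Lemma hoclassP x y (p q : path x y) : hoclass p = hoclass q <-> path_rel p q.
Proof.
split=> [/eqmodP/asboolP //|pq].
by apply/eqmodP/asboolP.
Qed.

Lemma horeprK x y (a : hohom x y) : hoclass (horepr a) = a.
Proof. exact: reprK. Qed.

Lemma horepr_rel x y (p : path x y) : path_rel (horepr (hoclass p)) p.
Proof. by apply/hoclassP; exact: horeprK. Qed.

Definition hocomp x y z (b : hohom y z) (a : hohom x y) : hohom x z :=
  hoclass (pcat (horepr a) (horepr b)).

Lemma hocompE x y z (q : path y z) (p : path x y) :
  hocomp (hoclass q) (hoclass p) = hoclass (pcat p q).
Proof. by apply/hoclassP; apply: PRcat; exact: horepr_rel. Qed.

Lemma pcatp0 x y (p : path x y) : pcat p (Pnil y) = p.
Proof. by elim: p => //= ? ? ? e p ->. Qed.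

Lemma pcatA x y z w (p : path x y) (q : path y z) (r : path z w) :
  pcat p (pcat q r) = pcat (pcat p q) r.
Proof. by elim: p q => //= ? ? ? e p IH q; rewrite IH. Qed.

Definition ho : cat.
Proof.
exists (X 0) hohom (fun x => hoclass (Pnil x)) hocomp.
- by move=> x y a; rewrite -(horeprK a) hocompE pcatp0.
- by move=> x y a; rewrite -(horeprK a) hocompE.
- move=> x y z w c b a.
  by rewrite -(horeprK a) -(horeprK b) -(horeprK c) !hocompE pcatA.
Defined.

End HomotopyCategory.

Section HomotopyFunctor.
Variables (X Y : sSet) (f : sMap X Y).

Definition edge_map x y (e : edge x y) : edge (f 0 x) (f 0 y).
Proof.
exists (f 1 (sval e)).
by case: (svalP e) => sx ty; rewrite -!smap_nat sx ty.
Defined.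

Fixpoint path_map x y (p : path x y) : path (f 0 x) (f 0 y) :=
  match p with
  | Pnil _ => Pnil _
  | Pcons _ _ _ e p' => Pcons (edge_map e) (path_map p')
  end.

Lemma path_map_cat x y z (p : path x y) (q : path y z) :
  path_map (pcat p q) = pcat (path_map p) (path_map q).
Proof. by elim: p q => //= ? ? ? e p IH q; rewrite IH. Qed.

Lemma path_map_rel x y (p q : path x y) :
  path_rel p q -> path_rel (path_map p) (path_map q).
Proof.
elim=> {x y p q} /=.
- by move=> x e ee; apply: PRdeg; rewrite /= ee smap_nat.
- move=> x y z a b c s sa sb sc.
  by apply: (@PRtri _ _ _ _ _ _ _ (f 2 s));
    rewrite -smap_nat /= ?sa ?sb ?sc.
- by move=> x y z p p' q q' _ IHp _ IHq; rewrite !path_map_cat; exact: PRcat.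
- by move=> x y p; exact: PRrefl.
- by move=> x y p q _; exact: PRsym.
- by move=> x y p q r _ pq _; exact: PRtrans.
Qed.

Definition ho_map : functor (ho X) (ho Y).
Proof.
exists (f 0 : ho X -> ho Y)
       (fun (x y : ho X) (a : hom x y) => hoclass (path_map (horepr a))).
- by move=> x; apply/hoclassP/(path_map_rel (horepr_rel _)).
- move=> x y z b a; rewrite /= hocompE -path_map_cat.
  by apply/hoclassP/path_map_rel; exact: horepr_rel.
Defined.

Lemma ho_mapE x y (p : path x y) :
  fhom ho_map (hoclass p : hom (x : ho X) y) = hoclass (path_map p).
Proof. by apply/hoclassP/path_map_rel/horepr_rel. Qed.

End HomotopyFunctor.

Definition vertex_simp n (i : 'I_n.+1) : simp 0 n :=
  @Simp 0 n (fun=> i) (fun _ _ _ => leqnn i).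

Definition edge_simp n (i j : 'I_n.+1) (ij : i <= j) : simp 1 n.
Proof.
exists (fun t : 'I_2 => if t == ord0 then i else j).
by case=> [[|[|?]] ?] // [[|[|?]] ?] //=.
Defined.

Definition simplex_edge (X : sSet) n (x : X n) (i j : 'I_n.+1) (ij : i <= j) :
  edge (act (vertex_simp i) x) (act (vertex_simp j) x).
Proof.
exists (act (edge_simp ij) x).
by split; rewrite -act_comp; congr act; apply: simp_ext => -[[|?] ?].
Defined.

Lemma edge_eq (X : sSet) (x y : X 0) (e e' : edge x y) :
  sval e = sval e' -> e = e'.
Proof. by move=> h; apply: eq_sig_hprop => // ? ? ?; exact: Prop_irrelevance. Qed.

Definition ho_unit_functor (X : sSet) n (x : X n) :
  functor (ord_cat n) (ho X).
Proof.
exists (fun i : ord_cat n => act (vertex_simp i) x : ho X)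
       (fun (i j : ord_cat n) (ij : hom i j) =>
          hoclass (pedge (simplex_edge x ij))).
- move=> i; apply/hoclassP; apply: PRdeg => /=.
  rewrite -act_comp; congr act; apply: simp_ext => t /=; by case: ifP.
- move=> i j k jk ij; rewrite /= hocompE; apply/esym/hoclassP.
  pose t3 (t : 'I_3) : 'I_n.+1 := match val t with 0 => i | 1 => j | _ => k end.
  have mt3 : {homo t3 : a b / a <= b}.
    have ik := leq_trans ij jk.
    by case=> [[|[|[|?]]] ?] // [[|[|[|?]]] ?] //=.
  by apply: (@PRtri _ _ _ _ _ _ _ (act (Simp mt3) x)); rewrite -act_comp;
     congr act; apply: simp_ext => -[[|[|?]] ?].
Defined.

Lemma hom_cast_edge (X : sSet) (x x' y y' : X 0) (e : edge x y)
    (e' : edge x' y') (ex : x = x') (ey : y = y') :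
  sval e = sval e' ->
  hom_cast (C := ho X) ex ey (hoclass (pedge e)) = hoclass (pedge e').
Proof.
case: _ / ex e'; case: _ / ey => e' ee.
by rewrite hom_cast_id (edge_eq ee).
Qed.

Definition ho_unit (X : sSet) : sMap X (nerve (ho X)).
Proof.
exists (fun n (x : X n) => ho_unit_functor x : nerve (ho X) n).
move=> m n a x.
have e i : act (vertex_simp i) (act a x) = act (vertex_simp (a i)) x.
  by rewrite -act_comp; congr act; apply: simp_ext.
apply: (@functor_ext _ _ (ho_unit_functor (act a x))
  (fcomp (ho_unit_functor x) (ord_functor a)) e) => i j ij.
apply: hom_cast_edge => /=; rewrite -act_comp; congr act; apply: simp_ext => t /=.
by case: ifP.
Defined.

Section Arrow.
Variable C : cat.

(* Arrows with their endpoints, to compare arrows of different hom types. *)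
Definition arr : Type := {x : C & {y : C & hom x y}}.
Definition mkarr (x y : C) (a : hom x y) : arr := existT _ x (existT _ y a).

Lemma mkarr_inj (x y : C) (a b : hom x y) : mkarr a = mkarr b -> a = b.
Proof.
move=> e; have := projT2_eq e.
rewrite (Prop_irrelevance (projT1_eq e) erefl) /= => {}e; have := projT2_eq e.
by rewrite (Prop_irrelevance (projT1_eq e) erefl).
Qed.

Lemma mkarr_cast (x x' y y' : C) (ex : x = x') (ey : y = y') (a : hom x y) :
  mkarr (hom_cast ex ey a) = mkarr a.
Proof. by case: _ / ex; case: _ / ey. Qed.

Lemma mkarr_comp (x y z x' y' z' : C) (b : hom y z) (a : hom x y)
    (b' : hom y' z') (a' : hom x' y') :
  mkarr b = mkarr b' -> mkarr a = mkarr a' ->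
  mkarr (comp b a) = mkarr (comp b' a').
Proof.
move=> eb ea.
have ey : y = y' by exact: (congr1 (fun t : arr => projT1 t) eb).
have ez : z = z' by exact: (congr1 (fun t : arr => projT1 (projT2 t)) eb).
have ex : x = x' by exact: (congr1 (fun t : arr => projT1 t) ea).
case: _ / ex a' ea; case: _ / ey a b' eb; case: _ / ez => a b' eb a' ea.
by rewrite (mkarr_inj eb) (mkarr_inj ea).
Qed.

Lemma mkarr_id (x y : C) : x = y -> mkarr (idm x) = mkarr (idm y).
Proof. by move->. Qed.

Lemma mkarr_ord n (F G : functor (ord_cat n) C) (i j i' j' : 'I_n.+1)
    (ij : i <= j) (ij' : i' <= j') :
  F = G -> i = i' -> j = j' ->
  mkarr (fhom F (ij : hom (i : ord_cat n) j)) =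
  mkarr (fhom G (ij' : hom (i' : ord_cat n) j')).
Proof.
move=> -> ei ej; case: _ / ei ij'; case: _ / ej => ij'.
by rewrite (bool_irrelevance ij ij').
Qed.

End Arrow.

Lemma mkarr_fhom (C D : cat) (G : functor C D) (x y x' y' : C) (a : hom x y)
    (a' : hom x' y') :
  mkarr a = mkarr a' -> mkarr (fhom G a) = mkarr (fhom G a').
Proof.
exact: (congr1 (fun t : arr C => mkarr (fhom G (projT2 (projT2 t))))).
Qed.

Section HoAdj.
Variables (X : sSet) (C : cat) (phi : sMap X (nerve C)).

Let ob0 (x : X 0) : C := (phi 0 x : functor (ord_cat 0) C) (ord0 : 'I_1).

Let phi_src x y (e : edge x y) :
  (phi 1 (sval e) : functor (ord_cat 1) C) (ord0 : 'I_2) = ob0 x.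
Proof.
case: e => e [/= ex ey]; rewrite /ob0 -ex smap_nat /=; congr fob.
exact: val_inj.
Qed.

Let phi_tgt x y (e : edge x y) :
  (phi 1 (sval e) : functor (ord_cat 1) C) (ord_max : 'I_2) = ob0 y.
Proof.
case: e => e [/= ex ey]; rewrite /ob0 -ey smap_nat /=; congr fob.
exact: val_inj.
Qed.

Let ehom x y (e : edge x y) : hom (ob0 x) (ob0 y) :=
  hom_cast (phi_src e) (phi_tgt e)
    (fhom (phi 1 (sval e) : functor (ord_cat 1) C)
       (isT : hom (ord0 : ord_cat 1) (ord_max : ord_cat 1))).

Let Fixpoint phom x y (p : path x y) : hom (ob0 x) (ob0 y) :=
  match p in path x y return hom (ob0 x) (ob0 y) with
  | Pnil _ => idm _
  | Pcons _ _ _ e p' => comp (phom p') (ehom e)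
  end.

Let phom_cat x y z (p : path x y) (q : path y z) :
  phom (pcat p q) = comp (phom q) (phom p).
Proof.
elim: p q => [?|? ? ? e p IH] q /=; first by rewrite comp_idr.
by rewrite IH comp_assoc.
Qed.

Let phom_rel x y (p q : path x y) : path_rel p q -> phom p = phom q.
Proof.
elim=> {x y p q} //=.
- move=> x e ee; rewrite comp_idl; apply: mkarr_inj; rewrite mkarr_cast.
  rewrite ee smap_nat /= -(fhom_id (phi 0 x : functor (ord_cat 0) C)).
  by apply: (mkarr_ord (F := phi 0 x)).
- move=> x y z a b c s sa sb sc; rewrite !comp_idl.
  pose i0 : 'I_3 := @Ordinal 3 0 isT; pose i1 : 'I_3 := @Ordinal 3 1 isT.
  pose i2 : 'I_3 := @Ordinal 3 2 isT.
  pose F : functor (ord_cat 2) C := phi 2 s.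
  have hc : mkarr (ehom c) = mkarr (fhom F (isT : hom (i0 : ord_cat 2) i2)).
    rewrite mkarr_cast -sc smap_nat /=.
    by apply: (mkarr_ord (F := F)) => //; exact: val_inj.
  have hb : mkarr (ehom b) = mkarr (fhom F (isT : hom (i1 : ord_cat 2) i2)).
    rewrite mkarr_cast -sb smap_nat /=.
    by apply: (mkarr_ord (F := F)) => //; exact: val_inj.
  have ha : mkarr (ehom a) = mkarr (fhom F (isT : hom (i0 : ord_cat 2) i1)).
    rewrite mkarr_cast -sa smap_nat /=.
    by apply: (mkarr_ord (F := F)) => //; exact: val_inj.
  apply: mkarr_inj; rewrite (mkarr_comp hb ha) hc -fhom_comp.
  exact: mkarr_ord.
- by move=> x y z p p' q q' _ ep _ eq; rewrite !phom_cat ep eq.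
- by move=> x y p q r _ -> _ ->.
Qed.

Let lift_functor : functor (ho X) C.
Proof.
exists (ob0 : ho X -> C) (fun (x y : ho X) (a : hom x y) => phom (horepr a)).
- by move=> x; rewrite (phom_rel (horepr_rel _)).
- by move=> x y z b a; rewrite (phom_rel (horepr_rel _)) phom_cat.
Defined.

Lemma nerve_functor_ob (n : nat) (x : X n) (i : 'I_n.+1) :
  (phi n x : functor (ord_cat n) C) i =
  (phi 0 (act (vertex_simp i) x) : functor (ord_cat 0) C) (ord0 : 'I_1).
Proof. by rewrite smap_nat. Qed.

(* [ho] is left adjoint to [nerve]: [ho_unit X] is universal from X to [nerve],
   and [ho_unit_natural] below identifies [ho_map] as the induced action on
   maps. *)
Lemma ho_adjunction :
  exists! F : functor (ho X) C, scomp (nerve_map F) (ho_unit X) = phi.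
Proof.
exists lift_functor; split.
- apply: smap_ext => n x /=.
  apply: (@functor_ext _ _ (fcomp lift_functor (ho_unit_functor x))
    (phi n x) (fun i => esym (nerve_functor_ob x i))) => i j ij.
  apply: mkarr_inj; rewrite mkarr_cast /= (phom_rel (horepr_rel _)) /=.
  rewrite comp_idl mkarr_cast /= smap_nat /=.
  by apply: (mkarr_ord (F := phi n x)).
- move=> G eG.
  have e x : lift_functor x = G x.
    rewrite /= /ob0 -eG /=; congr (G _).
    by rewrite -[RHS](act_id x); congr act; apply: simp_ext => t; rewrite /= ord1.
  apply: (functor_ext (e := e)) => x y a.
  rewrite -(horeprK a); elim: (horepr a) => {a x y} [x|x y z f p IH].
    apply: mkarr_inj; rewrite mkarr_cast /= (phom_rel (horepr_rel _)).
    rewrite (fhom_id G (x : ho X)) /=; apply: mkarr_id; exact: (e x).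
  apply: mkarr_inj; rewrite mkarr_cast /= (phom_rel (horepr_rel _)) /=.
  have -> : hoclass (Pcons f p) =
            comp (hoclass p : hom (y : ho X) z) (hoclass (pedge f)).
    by rewrite /= hocompE.
  rewrite fhom_comp; apply: mkarr_comp.
    by rewrite -IH mkarr_cast /= (phom_rel (horepr_rel _)).
  rewrite mkarr_cast.
  case: f => f [ex ey].
  case: _ / ex; case: _ / ey.
  have -> : phi 1 f = fcomp G (ho_unit_functor f) by rewrite -eG.
  have ex : act (vertex_simp ord0) f = act (coface ord_max) f.
    by congr act; apply: simp_ext => -[[|?] ?] //; exact: val_inj.
  have ey : act (vertex_simp ord_max) f = act (coface ord0) f.
    by congr act; apply: simp_ext => -[[|?] ?] //; exact: val_inj.
  pose f' : edge (act (coface ord_max) f) (act (coface ord0) f) :=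
    exist _ f (conj erefl erefl).
  have ef : sval (simplex_edge f (isT : (ord0 : 'I_2) <= ord_max)) = sval f'.
    rewrite /= -[RHS](act_id f); congr act.
    by apply: simp_ext => -[[|[|?]] ?] //; exact: val_inj.
  apply: (mkarr_fhom G).
  by rewrite -(hom_cast_edge ex ey ef) mkarr_cast.
Qed.

End HoAdj.

Lemma ho_unit_natural (X Y : sSet) (f : sMap X Y) :
  scomp (ho_unit Y) f = scomp (nerve_map (ho_map f)) (ho_unit X).
Proof.
apply: smap_ext => n x /=.
have e i : act (vertex_simp i) (f n x) = f 0 (act (vertex_simp i) x).
  by rewrite smap_nat.
apply: (@functor_ext _ _ (ho_unit_functor (f n x))
  (fcomp (ho_map f) (ho_unit_functor x)) e) => i j ij.
apply: mkarr_inj; rewrite mkarr_cast.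
rewrite [fhom (fcomp _ _) _](_ : _ =
    hoclass (pedge (edge_map f (simplex_edge x ij)))); last exact: ho_mapE.
rewrite -(hom_cast_edge (e i) (e j) (e := simplex_edge (f n x) ij)).
  by rewrite mkarr_cast.
by rewrite /= smap_nat.
Qed.

(* 1-cells are simplicial maps; the 2-cells g => h between maps A -> B are the
   arrows g -> h of the hom-category ho (B^A), and their vertical composition
   is the composition of that category. *)
Definition cell (A B : sSet) (g h : sMap A B) : Type :=
  @hom (ho (sexp B A)) (vertex g) (vertex h).

Definition cell_id (A B : sSet) (g : sMap A B) : cell g g :=
  @idm (ho (sexp B A)) (vertex g).

Definition vcomp (A B : sSet) (f g h : sMap A B) (beta : cell g h)
    (alpha : cell f g) : cell f h :=
  comp beta alpha.

(* 1-cells compose associatively and unitally only up to propositional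
   equality. *)
Definition cell_cast (A B : sSet) (g g' h h' : sMap A B)
    (eg : g = g') (eh : h = h') (alpha : cell g h) : cell g' h' :=
  @hom_cast (ho (sexp B A)) _ _ _ _
    (congr1 (@vertex A B) eg) (congr1 (@vertex A B) eh) alpha.

Lemma sexp_post_vertex (A B C : sSet) (k : sMap B C) (g : sMap A B) :
  sexp_post k A 0 (vertex g) = vertex (scomp k g).
Proof. exact: smap_ext. Qed.

Lemma sexp_pre_vertex (Z A B : sSet) (k : sMap Z A) (g : sMap A B) :
  sexp_pre B k 0 (vertex g) = vertex (scomp g k).
Proof. exact: smap_ext. Qed.

(* Horizontal composition with the identity 2-cell of a 1-cell k is the image
   under [ho] of composition with k, B^A -> C^A on one side and B^A -> B^Z on
   the other. *)
Definition whisker_l (A B C : sSet) (k : sMap B C) (g h : sMap A B)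
    (alpha : cell g h) : cell (scomp k g) (scomp k h) :=
  @hom_cast (ho (sexp C A)) _ _ _ _
    (sexp_post_vertex k g) (sexp_post_vertex k h)
    (fhom (ho_map (sexp_post k A)) alpha).

Definition whisker_r (Z A B : sSet) (g h : sMap A B) (alpha : cell g h)
    (k : sMap Z A) : cell (scomp g k) (scomp h k) :=
  @hom_cast (ho (sexp B Z)) _ _ _ _
    (sexp_pre_vertex k g) (sexp_pre_vertex k h)
    (fhom (ho_map (sexp_pre B k)) alpha).

(* (eps f) . (f eta) = id_f *)
Definition triangle_l (A B : sSet) (f : sMap B A) (u : sMap A B)
    (eta : cell (sid B) (scomp u f)) (eps : cell (scomp f u) (sid A)) : Prop :=
  vcomp (cell_cast (esym (scompA f u f)) (scompIs f) (whisker_r eps f))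
        (cell_cast (scompsI f) erefl (whisker_l f eta))
  = cell_id f.

(* (u eps) . (eta u) = id_u *)
Definition triangle_r (A B : sSet) (f : sMap B A) (u : sMap A B)
    (eta : cell (sid B) (scomp u f)) (eps : cell (scomp f u) (sid A)) : Prop :=
  vcomp (cell_cast (scompA u f u) (scompsI u) (whisker_l u eps))
        (cell_cast (scompIs u) erefl (whisker_r eta u))
  = cell_id u.

(* f -| u in the 2-category of quasi-categories; in particular its two 0-cells
   are required to be quasi-categories. *)
Definition qcat_adjunction (A B : sSet) (f : sMap B A) (u : sMap A B) : Prop :=
  [/\ is_qcat A, is_qcat B
    & exists (eta : cell (sid B) (scomp u f)) (eps : cell (scomp f u) (sid A)),
        triangle_l eta eps /\ triangle_r eta eps].

(* Main.v *)
(* If A is a quasi-category then so is A^X, because A extends any map along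
   the inclusion of (horn k) x X into Delta n x X: this inclusion is a
   transfinite composite of attachments of simplices along inner horns.
   For a simplex y = (a, x) whose last vertex over k-1 is the i-th, let y^+ be
   the simplex obtained by inserting (k, x_i) after position i, so that the
   face i+1 of y^+ is y.  Consider a partial map, maximal among those whose
   domain is closed under y |-> y^+, and a simplex y outside its domain of
   least dimension and then of least i.  The face i of y^+ has the dimension
   of y and a smaller last position over k-1, and the remaining ones are of
   the form z^+ for faces z of y; so y^+ can be attached along its inner horn
   at i+1, contradicting maximality.

   The adjunctions themselves come from the 2-functoriality of (-)^X and
   C^(-), given on 2-cells by ho applied to the simplicial maps
   B^A -> (B^X)^(A^X) and B^A -> (C^A)^(C^B), which commute strictly with
   pre- and postcomposition. *)

Require Import Defs.
From mathcomp Require Import all_boot zify.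
From mathcomp Require Import boolp classical_sets.

Set Implicit Arguments.
Unset Strict Implicit.
Unset Printing Implicit Defensive.

(** * Exponentials of quasi-categories *)

Lemma exists_minimal (P : nat -> Prop) :
  (exists n, P n) -> exists2 n, P n & forall m, m < n -> ~ P m.
Proof.
move=> exP.
have exb : exists n, `[< P n >] by case: exP => n Pn; exists n; apply/asboolP.
case: (ex_minnP exb) => n /asboolP Pn minn; exists n => // m mn Pm.
by have /minn := asboolT Pm; rewrite leqNgt mn.
Qed.

(** * Monotone maps and horns *)

Lemma simp_lt m n (a : simp m n) i j : a i < a j -> i < j.
Proof. by apply: contraLR; rewrite -!leqNgt; exact: simp_mono. Qed.

(** Injectivity makes [c] strictly increasing, so [i <= c i] by induction from 0 and [c i <= i] by
    induction down from [n]. *)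
Lemma simp_inj_id n (c : simp n n) : injective c -> c = simp_id n.
Proof.
move=> inj_c.
have lt_c (i j : 'I_n.+1) : i < j -> c i < c j.
  move=> ij; rewrite ltn_neqAle (simp_mono c (ltnW ij)) andbT.
  by apply: contraTneq ij => /val_inj/inj_c ->; rewrite ltnn.
have ge_c m : forall i : 'I_n.+1, val i = m -> m <= c i.
  elim: m => // m IH i im.
  have mn : m < n.+1.
    by have := ltn_ord i; rewrite -[X in X < _]/(val i) im; lia.
  apply: leq_ltn_trans (IH (Ordinal mn) erefl) (lt_c _ _ _).
  by rewrite /= im.
have le_c m : forall i : 'I_n.+1, i + m = n -> c i <= i.
  elim: m => [|m IH] i im; first by have := ltn_ord (c i); lia.
  have mn : i.+1 < n.+1 by lia.
  have := lt_c i (Ordinal mn) (ltnSn i).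
  by have := IH (Ordinal mn); rewrite /=; lia.
apply: simp_ext => i; apply: ord_inj => /=; apply/eqP; rewrite eqn_leq.
by rewrite ge_c // (le_c (n - i)) // subnKC // -ltnS ltn_ord.
Qed.

Lemma not_in_hornP n (k : 'I_n.+1) m (a : simp m n) :
  ~ in_horn k a <-> forall i, i != k -> exists j, a j = i.
Proof.
split=> [nh i ik|hit [i ik ai]]; last first.
  by have [j aj] := hit i ik; move: (ai j); rewrite aj eqxx.
apply: contrapT => ne; apply: nh; exists i => // j.
by apply/negP => /eqP aj; apply: ne; exists j.
Qed.

Lemma in_horn_face n (k : 'I_n.+2) l (b : simp l n.+1) :
  in_horn k b -> exists j, exists2 b' : simp l n,
    j != k & b = simp_comp (coface j) b'.
Proof.
case=> j jk bj; exists j.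
have ub t : unbump j (b t) < n.+1.
  have := ltn_ord (b t); have := ltn_ord j; have := bj t.
  rewrite -val_eqE /= /unbump; lia.
have mb : {homo (fun t => Ordinal (ub t)) : s t / s <= t}.
  move=> s t st /=; have := simp_mono b st; rewrite /unbump; lia.
exists (Simp mb) => //.
apply: simp_ext => t; apply: ord_inj => /=; rewrite unbumpK //.
by move: (bj t); rewrite inE -val_eqE.
Qed.

(** Outside the horn [b] hits every vertex other than [k]. Choosing preimages, with [t] chosen for
    [b t], gives the section; it is monotone because [b] reflects strict inequalities. *)
Lemma not_in_horn_section n (k : 'I_n.+2) l (b : simp l n.+1) (t : 'I_l.+1) :
  ~ in_horn k b -> b t != k ->
  exists2 c : simp n l, simp_comp b c = coface k & exists s, c s = t.
Proof.
move=> /not_in_hornP hit btk.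
have ex (s : 'I_n.+1) : exists j, b j = lift k s /\ (lift k s = b t -> j = t).
  have [e|ne] := eqVneq (lift k s) (b t); first by exists t.
  have [|j bj] := hit (lift k s); first by rewrite eq_sym neq_lift.
  by exists j; split=> // e; rewrite e eqxx in ne.
have [c hc] := choice ex.
have mc : {homo c : s s' / s <= s'}.
  move=> s s'; rewrite leq_eqVlt => /orP[/eqP/val_inj -> //|ss'].
  apply/ltnW/(@simp_lt _ _ b).
  by rewrite (hc s).1 (hc s').1 /= /bump; lia.
exists (Simp mc); first by apply: simp_ext => s /=; exact: (hc s).1.
have [s bs _] := unlift_some (h := k) (i := b t) ltac:(by rewrite eq_sym).
by exists s; apply: (hc s).2.
Qed.

Lemma not_in_horn_face n (k : 'I_n.+2) (e : simp n n.+1) :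
  ~ in_horn k e -> e = coface k.
Proof.
move=> nh; have [t et] : exists t, e t != k.
  have [|t et] := (not_in_hornP k e).1 nh (lift k ord0).
    by rewrite eq_sym neq_lift.
  by exists t; rewrite et eq_sym neq_lift.
have [c ec _] := not_in_horn_section nh et.
suff c1 : c = simp_id n by rewrite -ec c1; exact: simp_ext.
apply: simp_inj_id => s s' cs; apply: (@lift_inj _ k).
by move: (congr1 (fun a : simp _ _ => a s) ec)
         (congr1 (fun a : simp _ _ => a s') ec) => /= <- <-; rewrite cs.
Qed.

Lemma simp_eq_off_vertex n (k : 'I_n.+1) l (b b' : simp l n) :
  (forall t, b t != k -> b' t = b t) -> (forall t, b' t != k -> b t = b' t) ->
  b = b'.
Proof.
move=> h h'; apply: simp_ext => t.
have [bk|/h -> //] := eqVneq (b t) k.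
by have [b'k|/h' -> //] := eqVneq (b' t) k; rewrite bk b'k.
Qed.

Lemma codegen_subproof n (i : 'I_n.+1) :
  {s : simp n.+1 n | forall t, s t = t - (i < t) :> nat}.
Proof.
have ub (t : 'I_n.+2) : t - (i < t) < n.+1.
  by have := ltn_ord i; have := ltn_ord t; lia.
have mf : {homo (fun t => Ordinal (ub t)) : r t / r <= t}.
  by move=> r t /=; lia.
by exists (Simp mf).
Qed.

(** The codegeneracy taking the value [i] twice. It comes from an opaque lemma, so simplification
    leaves it folded and [codegenE] gives its values. *)
Definition codegen n (i : 'I_n.+1) : simp n.+1 n := sval (codegen_subproof i).

Lemma codegenE n (i : 'I_n.+1) (t : 'I_n.+2) : codegen i t = t - (i < t) :> nat.
Proof. exact: (svalP (codegen_subproof i)). Qed.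

(** * Inserting the vertex k into simplices of the prism *)

Section Prism.
Local Open Scope classical_set_scope.
Variables (n : nat) (k : 'I_n.+1) (X : sSet).
Let Y := sprod (Delta n) X.

Definition last_below m (a : simp m n) (i : 'I_m.+1) : Prop :=
  (a i).+1 = k /\ forall t : 'I_m.+1, i < t -> k <= a t.

(* [cone y i w] says that w is y^+, i being the last position over k-1. *)
Definition cone m (y : Y m) (i : 'I_m.+1) (w : Y m.+1) : Prop :=
  (forall t, w.1 t = if t == i.+1 :> nat then k else y.1 (codegen i t)) /\
  w.2 = act (codegen i) y.2.

Lemma cone_uniq m (y : Y m) i w w' : cone y i w -> cone y i w' -> w = w'.
Proof.
case: w w' => [a x] [a' x'] [/= ea ->] [/= ea' ->]; congr (_, _).
by apply: simp_ext => t; rewrite ea ea'.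
Qed.

(** Values up to position [i] lie below [k] and later ones are at least [k], so inserting [k] right
    after [i] keeps the map monotone. *)
Lemma cone_exists m (y : Y m) i : last_below y.1 i -> exists w, cone y i w.
Proof.
move=> [yi ky].
pose a (t : 'I_m.+2) := if t == i.+1 :> nat then k else y.1 (codegen i t).
have ma : {homo a : s t / s <= t}.
  move=> s t st; rewrite /a.
  have hi (r : 'I_m.+2) : r <= i -> y.1 (codegen i r) < k.
    by move=> ri; rewrite -yi ltnS; apply: simp_mono; rewrite codegenE; lia.
  have hk (r : 'I_m.+2) : i.+1 < r -> k <= y.1 (codegen i r).
    by move=> ri; apply: ky; rewrite codegenE; lia.
  case: eqP => si; case: eqP => ti //.
  - by apply: hk; lia.
  - by apply/ltnW/hi; lia.
  - by apply/simp_mono/simp_mono.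
by exists (Simp ma : Delta n _, act (codegen i) y.2).
Qed.

Lemma last_below_exists m (a : simp m n) :
  0 < k -> ~ in_horn k a -> exists i, last_below a i.
Proof.
move=> k0 /not_in_hornP hit.
have kn : k.-1 < n.+1 by have := ltn_ord k; lia.
have [|j aj] := hit (Ordinal kn); first by rewrite -val_eqE /=; lia.
have aj1 : (a j).+1 == k by rewrite aj /= prednK.
case: (arg_maxnP (P := fun j => (a j).+1 == k) val aj1) => i /eqP ai maxi.
have {}maxi t : (a t).+1 = k -> t <= i by move/eqP/maxi.
exists i; split=> // t it; have := simp_mono a (ltnW it).
by have := maxi t; lia.
Qed.

Lemma cone_act l m (y : Y l) (i : 'I_l.+1) (w : Y l.+1)
    (b : simp m.+1 l.+1) (c : simp m l) (j : 'I_m.+1) :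
  cone y i w ->
  (forall t, codegen i (b t) = c (codegen j t)) ->
  (forall t, (b t == i.+1 :> nat) = (t == j.+1 :> nat)) ->
  cone (act c y) j (act b w).
Proof.
move=> [wa wx] bc bi; split=> [t|] /=; first by rewrite wa bi bc.
by rewrite wx -!act_comp; congr act; exact: simp_ext.
Qed.

Lemma cone_base m (y : Y m) (i : 'I_m.+1) w (ltim : i.+1 < m.+2) :
  cone y i w -> act (coface (Ordinal ltim)) w = y.
Proof.
move=> [wa wx]; rewrite [y]surjective_pairing /=; congr (_, _).
  apply: simp_ext => t /=; rewrite wa /= /bump.
  case: eqP => [|_]; first lia.
  by congr (y.1 _); apply: ord_inj; rewrite codegenE /= /bump; lia.
rewrite wx -act_comp -[RHS]act_id; congr act; apply: simp_ext => t.
by apply: ord_inj; rewrite [LHS]codegenE /= /bump; lia.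
Qed.

Lemma cone_face m (y : Y m.+1) (i : 'I_m.+2) (w : Y m.+2) (j : 'I_m.+3) :
  last_below y.1 i -> cone y i w -> j != i :> nat -> j != i.+1 :> nat ->
  exists j' i', last_below (act (coface j') y).1 i' /\
    cone (act (coface j') y) i' (act (coface j) w).
Proof.
move=> [yi ky] cw ji ji1.
have := ltn_ord i; have := ltn_ord j => jm im.
(* Deleting position [j] of the cone deletes position [j] of [y] if [j < i] and [j - 1] if
   [j > i + 1]; position [i] moves down by one exactly when [j < i]. *)
have lj' : unbump i j < m.+2 by rewrite /unbump; lia.
have li' : unbump j i < m.+1 by rewrite /unbump; lia.
exists (Ordinal lj'), (Ordinal li'); split; first split.
- rewrite -yi /=; congr (nat_of_ord (y.1 _)).+1; apply: ord_inj.
  by rewrite /= /bump /unbump; lia.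
- by move=> t it; apply: ky; move: it; rewrite /= /bump /unbump; lia.
apply: cone_act cw _ _ => t.
  apply: ord_inj; rewrite codegenE.
  by rewrite /= /bump codegenE /= /unbump; lia.
by rewrite /= /bump /unbump; lia.
Qed.

(** As [b] hits [i], and [w] takes values at least [k] after [i], the last position [s] over [k - 1]
    is sent to [i]. So [z] is the pullback of [w] along [b] with the value [i + 1] inserted after
    [s]. *)
Lemma cone_of_cone l m (y : Y m) i w (b : simp l m.+1) (s : 'I_l.+1) z :
  last_below y.1 i -> cone y i w -> (exists t, b t = i :> nat) ->
  last_below (act b w).1 s -> cone (act b w) s z ->
  exists b', z = act b' w.
Proof.
move=> [yi ky] cw [t0 bt0] [/= ws kw] cz.
have wa : forall t, _ := cw.1.
have wE (t : 'I_m.+2) : t <= i -> w.1 t <= y.1 i.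
  move=> ti; rewrite wa; case: eqP; first lia.
  by move=> _; apply: simp_mono; rewrite codegenE; lia.
have wk (t : 'I_m.+2) : i < t -> k <= w.1 t.
  move=> ti; rewrite wa; case: eqP => // ti1.
  by apply: ky; rewrite codegenE; lia.
have bs : b s <= i by rewrite leqNgt; apply/negP => /wk; rewrite -ws ltnn.
have ts : t0 <= s.
  rewrite leqNgt; apply/negP => /kw /leq_trans/(_ (wE (b t0) _)).
  by rewrite bt0 -yi ltnn => /(_ (leqnn _)).
have {ts t0 bt0}bs : b s = i :> nat.
  by apply/eqP; rewrite eqn_leq bs -bt0 simp_mono.
have i1 : i.+1 < m.+2 by have := ltn_ord i; lia.
pose f (t : 'I_l.+2) : 'I_m.+2 :=
  if t == s.+1 :> nat then Ordinal i1 else b (codegen s t).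
have hb (t : 'I_l.+1) : s < t -> i < b t.
  move=> st; rewrite ltnNge; apply/negP => /wE/(leq_trans (kw t st)).
  by rewrite -yi ltnn.
have mf : {homo f : r r' / r <= r'}.
  move=> r r' rr'; rewrite /f.
  have lo (t' : 'I_l.+2) : t' <= s -> b (codegen s t') <= i.
    by move=> t's; rewrite -bs; apply: simp_mono; rewrite codegenE; lia.
  have hi (t' : 'I_l.+2) : s.+1 < t' -> i < b (codegen s t').
    by move=> t's; apply: hb; rewrite codegenE; lia.
  case: eqP => rs; case: eqP => rs' //=.
  - by apply: hi; lia.
  - by have := lo r; lia.
  - by apply/simp_mono/simp_mono.
exists (Simp mf); apply: cone_uniq cz _; split=> [t|] /=.
  by rewrite /f; case: eqP => // _; rewrite wa /= eqxx.
rewrite cw.2 -!act_comp; congr act; apply: simp_ext => t; apply: ord_inj.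
change (codegen i (f t) = codegen i (b (codegen s t)) :> nat).
rewrite !codegenE /f; case: eqP => // ts.
have -> : codegen s t = s by apply: ord_inj; rewrite codegenE; lia.
by rewrite bs /=; lia.
Qed.

(** * Partial maps on the prism *)

Variable A : sSet.
Hypothesis qA : is_qcat A.
Hypothesis kn : 0 < k < n.
Variable H : sMap (sprod (horn k) X) A.

(* Partial maps from Delta n x X to A are handled as graphs. *)
Let graph := set {m : nat & Y m * A m}%type.
Let rel (R : graph) m (y : Y m) (v : A m) : Prop := R (existT _ m (y, v)).
Let dom (R : graph) m (y : Y m) : Prop := exists v, rel R y v.

Definition horn_graph : graph := fun t => exists hb : in_horn k (projT2 t).1.1,
  (projT2 t).2 = H _ (exist _ (projT2 t).1.1 hb, (projT2 t).1.2).

(** These are the graphs of simplicial maps to [A] from subcomplexes of the prism closed under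
    [y |-> y^+]. *)
Definition good_graph (R : graph) : Prop :=
  [/\ forall m (y : Y m) v v', rel R y v -> rel R y v' -> v = v',
      forall l m (b : simp l m) (y : Y m) v, rel R y v ->
        rel R (act b y) (act b v)
    & forall m (y : Y m) i w, last_below y.1 i -> cone y i w ->
        dom R y -> dom R w].

(** For closure under cones: a vertex other than [k] that is missed by [y] is still missed once [k]
    is inserted. *)
Lemma horn_graph_good : good_graph horn_graph.
Proof.
split.
- move=> m [b x] v v' [hb /= ->] [hb' /= ->].
  by rewrite (Prop_irrelevance hb hb').
- move=> l m c [b x] v [hb /= ->]; exists (in_horn_act c hb).
  by rewrite -smap_nat; congr (H _ (_, _)); exact: eq_exist.
- move=> m [b x] i [a z] [/= bi kb] [/= ab _] [v [[j jk bj] _]].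
  have ha : in_horn k a.
    exists j => // t; rewrite ab.
    by case: ifP => _; [rewrite eq_sym | exact: bj].
  by exists (H _ (exist _ a ha, z)), ha.
Qed.

Lemma good_graph_act R l m (b : simp l m) (y : Y m) :
  good_graph R -> dom R y -> dom R (act b y).
Proof. by move=> [_ cl _] [v yv]; exists (act b v); exact: cl. Qed.

(** Any two pairs of the union lie in a common member of the chain. Adjoining the graph of [H]
    outside the union covers the empty chain too. *)
Lemma good_graph_union (F : set graph) :
  total_on F subset -> (forall R, F R -> good_graph (horn_graph `|` R)) ->
  good_graph (horn_graph `|` \bigcup_(R in F) R).
Proof.
move=> totF goodF; have [hf hc hs] := horn_graph_good.
split.
- move=> m y v v' [yv|[R FR yv]] [yv'|[R' FR' yv']].
  + exact: hf yv yv'.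
  + by have [f _ _] := goodF _ FR'; apply: (f _ y); [left|right].
  + by have [f _ _] := goodF _ FR; apply: (f _ y); [right|left].
  + have [RR'|R'R] := totF _ _ FR FR'.
      have [f _ _] := goodF _ FR'; apply: (f _ y); last by right.
      by right; exact: RR'.
    have [f _ _] := goodF _ FR; apply: (f _ y); first by right.
    by right; exact: R'R.
- move=> l m b y v [yv|[R FR yv]]; first by left; exact: hc.
  have [_ c _] := goodF _ FR.
  by have [|] := c _ _ b y v (or_intror yv); [left|right; exists R].
- move=> m y i w yi cw [v [yv|[R FR yv]]].
    by have [v' wv'] := hs _ _ _ _ yi cw (ex_intro _ v yv); exists v'; left.
  have [_ _ s] := goodF _ FR.
  have [v' [wv'|wv']] := s _ _ _ _ yi cw (ex_intro _ v (or_intror yv)).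
    by exists v'; left.
  by exists v'; right; exists R.
Qed.

(** * Attaching one simplex along an inner horn *)

Section Attach.
Variables (R : graph) (m : nat) (w : Y m.+1) (o : 'I_m.+2).
Hypothesis goodR : good_graph R.
Hypothesis o_inner : 0 < o < m.+1.
Hypothesis face_w : forall j, j != o -> dom R (act (coface j) w).
Hypothesis oface_w : ~ dom R (act (coface o) w).

(** A simplex outside the horn has a section over face [o], so its presence in the domain would
    bring in the missing face; one inside factors through a face other than [o]. *)
Lemma dom_in_horn l (b : simp l m.+1) : dom R (act b w) <-> in_horn o b.
Proof.
split=> [dbw|hb].
  apply: contrapT => nhb; apply: oface_w.
  have [t bt] : exists t, b t != o.
    have [|t bt] := (not_in_hornP o b).1 nhb (lift o ord0).
      by rewrite eq_sym neq_lift.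
    by exists t; rewrite bt eq_sym neq_lift.
  have [c <- _] := not_in_horn_section nhb bt.
  by rewrite act_comp; exact: good_graph_act.
have [j [b' jo ->]] := in_horn_face hb.
by rewrite act_comp; apply: good_graph_act => //; exact: face_w.
Qed.

Lemma horn_filler : exists F : sMap (Delta m.+1) A,
  forall l (b : simp l m.+1) v, rel R (act b w) v -> v = F l b.
Proof.
have [fR cR _] := goodR.
have ex l (b : horn o l) : {v | rel R (act (sval b) w) v}.
  by apply: cid; apply/dom_in_horn; exact: (svalP b).
pose hm l (b : horn o l) : A l := sval (ex l b).
have hm_nat l l' (c : simp l l') (b : horn o l') :
    hm l (act c b) = act c (hm l' b).
  apply: fR (svalP (ex l (act c b))) _.
  have -> : act (sval (act c b)) w = act c (act (sval b) w).
    exact: act_comp.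
  by apply: cR; exact: (svalP (ex l' b)).
have [F FE] := qA o_inner (SMap hm_nat).
exists F => l b v bv.
have hb : in_horn o b by apply/dom_in_horn; exists v.
rewrite -[b]/(horn_incl o l (exist _ b hb)).
rewrite -[F _ _]/(scomp F (horn_incl o) l (exist _ b hb)) FE /=.
exact: fR bv (svalP (ex l (exist _ b hb))).
Qed.

(* The sections of b over the face o send b' onto that face too. *)
Lemma act_inj_off_horn l (b b' : simp l m.+1) :
  act b w = act b' w -> ~ in_horn o b -> b = b'.
Proof.
move=> bb' nhb.
have nhb' : ~ in_horn o b' by move/dom_in_horn; rewrite -bb' => /dom_in_horn.
have sub (a a' : simp l m.+1) : ~ in_horn o a -> act a w = act a' w ->
    forall t, a t != o -> a' t = a t.
  move=> nha aa' t at_o.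
  have [c ac [s <-]] := not_in_horn_section nha at_o.
  have a'c : simp_comp a' c = coface o.
    apply: not_in_horn_face => /dom_in_horn.
    by rewrite act_comp -aa' -act_comp ac.
  have := congr1 (fun e : simp _ _ => e s) a'c.
  by have := congr1 (fun e : simp _ _ => e s) ac => /= -> ->.
by apply: (simp_eq_off_vertex (k := o)); apply: sub.
Qed.

Hypothesis sat_w : forall l (b : simp l m.+1) s z, ~ in_horn o b ->
  last_below (act b w).1 s -> cone (act b w) s z -> exists b', z = act b' w.

(** The pairs of [act b w] and [F _ b] are added to [R]. This is consistent: on the horn [F] agrees
    with [R], and off the horn [act b w] determines [b]. Closure under cones of the new simplices is
    [sat_w]. *)
Lemma good_graph_attach : exists R' : graph,
  [/\ good_graph R', R `<=` R' & dom R' w].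
Proof.
have [F FE] := horn_filler; have [fR cR sR] := goodR.
pose R' : graph := R `|` fun t => exists2 b : simp (projT1 t) m.+1,
  (projT2 t).1 = act b w & (projT2 t).2 = F _ b.
have R'E l (y : Y l) v : rel R' y v <->
    rel R y v \/ exists2 b : simp l m.+1, y = act b w & v = F _ b.
  exact: iff_refl.
exists R'; split; last 2 first.
- by move=> t; left.
- exists (F _ (simp_id _)); apply/R'E; right; exists (simp_id _) => //.
  by rewrite act_id.
split.
- move=> l y v v' /R'E[yv|[b yb ->]] /R'E[yv'|[b' yb' ->]].
  + exact: fR yv yv'.
  + by apply: FE; rewrite -yb'.
  + by apply/esym/FE; rewrite -yb.
  + have bb' : act b w = act b' w by rewrite -yb.
    have [/dom_in_horn[v0 bv0]|nhb] := pselect (in_horn o b).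
      by rewrite -(FE _ _ _ bv0); apply: FE; rewrite -bb'.
    by rewrite (act_inj_off_horn bb' nhb).
- move=> l l' c y v /R'E[yv|[b -> ->]]; apply/R'E; first by left; exact: cR.
  by right; exists (simp_comp b c); [rewrite act_comp | rewrite -smap_nat].
- move=> l y i z yi cz dy.
  have [/(sR _ _ _ _ yi cz)[v zv]|nd] := pselect (dom R y).
    by exists v; left.
  case: dy => v /R'E[yv|[b yb _]]; first by case: nd; exists v.
  have [|||b' ->] := @sat_w _ b i z.
  + by move/dom_in_horn; rewrite -yb.
  + by rewrite -yb.
  + by rewrite -yb.
  + by exists (F _ b'); apply/R'E; right; exists b'.
Qed.

End Attach.

(** * Extension to the whole prism *)

Lemma cone_face_dom R m (y : Y m) (i : 'I_m.+1) w (j : 'I_m.+2) :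
  good_graph R -> (forall l, l < m -> forall z : Y l, dom R z) -> i < m ->
  last_below y.1 i -> cone y i w -> j != i :> nat -> j != i.+1 :> nat ->
  dom R (act (coface j) w).
Proof.
move=> [_ _ sR]; case: m y i w j => [|m] y i w j lower im yi cw ji ji1.
  by move: im; rewrite ltn0.
have [j' [i' [y'i' cw']]] := cone_face yi cw ji ji1.
by apply: sR y'i' cw' _; exact: lower.
Qed.

Lemma good_graph_extend (R : graph) : good_graph R -> horn_graph `<=` R ->
  (exists m (y : Y m), ~ dom R y) ->
  exists R' : graph, [/\ good_graph R', R `<=` R' & ~ R' `<=` R].
Proof.
move=> goodR hR /exists_minimal[m nd min_m].
have base (y : Y m) : in_horn k y.1 -> dom R y.
  by move=> hy; exists (H _ (exist _ y.1 hy, y.2)); apply: hR; exists hy.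
have below (y : Y m) : ~ dom R y -> exists i, last_below y.1 i.
  by move=> ndy; apply: last_below_exists; [case/andP: kn|move/base].
have /exists_minimal[i0 [y [i [ndy yi <-]]] min_i] :
    exists i0, exists (y : Y m) (i : 'I_m.+1),
      [/\ ~ dom R y, last_below y.1 i & i = i0 :> nat].
  by have [y ndy] := nd; have [i yi] := below y ndy; exists i, y, i.
have [w cw] := cone_exists yi; have [yik ky] := yi.
(* If [i] were the last position, [y] would take only values up to [k - 1], hence miss the vertex
   [n], which differs from [k], and lie in the horn. *)
have im : i < m.
  rewrite ltn_neqAle -ltnS ltn_ord andbT; apply/eqP => im.
  apply: ndy; apply: base; have [k0 kn'] := andP kn.
  exists (ord_max : 'I_n.+1); first by rewrite -val_eqE /=; lia.
  move=> t; rewrite -val_eqE neq_ltn (leq_trans _ kn') //.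
  rewrite ltnS -yik ltnW // ltnS.
  by apply: simp_mono; have := ltn_ord t; lia.
have lt_o : i.+1 < m.+2 by lia.
have yE : act (coface (Ordinal lt_o)) w = y by exact: cone_base.
have [|||l b s z|R' [gR' RR' [v wv]]] :=
  @good_graph_attach R m w (Ordinal lt_o) goodR.
- exact: im.
(* From position [i] on, face [i] has values at least [k]; were it missing, its last position over
   [k - 1] would be below [i], against minimality. The other faces are cones on faces of [y]. *)
- move=> j jo; have [ji|ji] := eqVneq (j : nat) i.
    apply: contrapT => nd'; have [i' [i'k ki']] := below _ nd'.
    apply: (min_i i'); last by exists (act (coface j) w), i'.
    rewrite ltnNge; apply/negP => ii'; move: i'k => /=.
    have: k <= w.1 (lift j i').
      rewrite cw.1; case: eqP => // ne; apply: ky; rewrite codegenE /= /bump.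
      by move: ne; rewrite /= /bump; lia.
    by move=> + e; rewrite -e ltnn.
  apply: cone_face_dom goodR _ im yi cw ji jo => l /min_m nd' z.
  by apply: contrapT => ndz; apply: nd'; exists z.
- by rewrite yE.
- move=> /not_in_hornP hit; apply: cone_of_cone yi cw _.
  have ltim : i < m.+2 by lia.
  have [|t bt] := hit (Ordinal ltim); first by rewrite -val_eqE /=; lia.
  by exists t; rewrite bt.
- exists R'; split=> // R'R; apply: ndy; rewrite -yE.
  by apply: good_graph_act => //; exists v; apply: R'R.
Qed.

Lemma prism_extension : exists G : sMap Y A,
  scomp G (sprod_map (horn_incl k) (sid X)) = H.
Proof.
have [|G [goodG maxG]] :=
    @Zorn_bigcup _ (fun R : graph => good_graph (horn_graph `|` R)).
  by move=> F goodF totF; exact: good_graph_union.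
set R := horn_graph `|` G in goodG.
have hR : horn_graph `<=` R by move=> t; left.
have total m (y : Y m) : {v | rel R y v}.
  apply: cid; apply: contrapT => ndy.
  have [|R' [goodR' RR' nR'R]] := good_graph_extend goodG hR.
    by exists m, y.
  have hR' : horn_graph `|` R' = R'.
    by apply/setUidPr => t /hR/RR'.
  apply: (maxG R'); last by rewrite hR'.
  split=> [|R'G]; first by move=> t Gt; apply: RR'; right.
  by apply: nR'R => t /R'G; right.
have [fR cR _] := goodG.
have G_nat l m (b : simp l m) (y : Y m) :
    sval (total l (act b y)) = act b (sval (total m y)).
  apply: fR (svalP (total l (act b y))) _.
  exact: cR (svalP (total m y)).
exists (SMap G_nat); apply: smap_ext => m [b x].
apply: fR (svalP (total m _)) _; apply: hR; exists (svalP b) => /=.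
by congr (H _ (_, _)); case: (b) => *; exact: eq_exist.
Qed.

End Prism.

(** * Passing between the prism and the exponential *)

(** The transpose evaluates [h b] at the identity simplex; it is simplicial by naturality of [h] and
    of [h b]. *)
Lemma sexp_uncurry (K X A : sSet) (h : sMap K (sexp A X)) :
  exists H : sMap (sprod K X) A,
    forall m (b : K m) x, H m (b, x) = h m b m (simp_id m, x).
Proof.
have H_nat l m (c : simp l m) (p : sprod K X m) :
    h l (act c p).1 l (simp_id l, (act c p).2) =
    act c (h m p.1 m (simp_id m, p.2)).
  have -> : h l (act c p).1 = act c (h m p.1) by exact: smap_nat.
  rewrite -(smap_nat (h m p.1 : sMap _ _)) /=.
  by congr (h m p.1 _ (_, _)); exact: simp_ext.
by exists (SMap H_nat).
Qed.

Lemma sexp_qcat (A X : sSet) : is_qcat A -> is_qcat (sexp A X).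
Proof.
move=> qA n k kn h.
have [H HE] := sexp_uncurry h.
have [G GE] := prism_extension qA kn H.
have curry_nat l m (c : simp l m) (b : Delta n m) :
    scomp G (sprod_map (Delta_map (act c b)) (sid X)) =
    act c (scomp G (sprod_map (Delta_map b) (sid X)) : sexp A X m).
  by apply: smap_ext => r [d x] /=; congr (G _ (_, _)); exact: simp_ext.
exists (SMap (smap_fun := fun m (b : Delta n m) =>
  scomp G (sprod_map (Delta_map b) (sid X)) : sexp A X m) curry_nat).
apply: smap_ext => m b; apply: smap_ext => l [c x] /=.
(* By naturality [h b] at [(c, x)] is [h] of [act c b] at the identity and [x], so [H] determines
   [h]. *)
have <- : H l (act c b, x) = h m b l (c, x).
  rewrite HE smap_nat /=; congr (h m b _ (_, _)); exact: simp_ext.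
by rewrite -GE.
Qed.

(** * Exponentiation on 2-cells *)

Lemma ho_map_scomp (X Y Z : sSet) (g : sMap Y Z) (f : sMap X Y) (x y : ho X)
    (a : hom x y) :
  fhom (ho_map g) (fhom (ho_map f) a) = fhom (ho_map (scomp g f)) a.
Proof.
rewrite -(horeprK a) !ho_mapE /=; congr hoclass.
elim: (horepr a) => //= {a}{}x {}y z e p ->; congr Pcons; exact: edge_eq.
Qed.

(** The hom types on the two sides agree only propositionally, so the arrows are compared together
    with their endpoints. *)
Lemma mkarr_ho_map (X Y Y' Z : sSet) (g : sMap Y Z) (f : sMap X Y)
    (g' : sMap Y' Z) (f' : sMap X Y') (x y : ho X) (a : hom x y) :
  scomp g f = scomp g' f' ->
  mkarr (fhom (ho_map g) (fhom (ho_map f) a)) =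
  mkarr (fhom (ho_map g') (fhom (ho_map f') a)).
Proof.
rewrite !ho_map_scomp.
exact: (congr1 (fun F => mkarr (fhom (ho_map F) a))).
Qed.

(** * Transport of 2-cells along maps of exponentials *)

Section CellMap.
Variables (A B A' B' : sSet) (Phi : sMap (sexp B A) (sexp B' A')).
Variables (g h : sMap A B) (g' h' : sMap A' B').
Hypothesis eg : Phi 0 (vertex g) = vertex g'.
Hypothesis eh : Phi 0 (vertex h) = vertex h'.

Definition cell_map (alpha : cell g h) : cell g' h' :=
  @hom_cast (ho (sexp B' A')) _ _ _ _ eg eh (fhom (ho_map Phi) alpha).

Lemma mkarr_cell_map alpha :
  mkarr (cell_map alpha) = mkarr (fhom (ho_map Phi) alpha).
Proof. exact: mkarr_cast. Qed.

End CellMap.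

Lemma mkarr_cast_whisker_l (A B C : sSet) (k : sMap B C) (g h : sMap A B)
    g' h' (eg : scomp k g = g') (eh : scomp k h = h') (alpha : cell g h) :
  mkarr (cell_cast eg eh (whisker_l k alpha)) =
  mkarr (fhom (ho_map (sexp_post k A)) alpha).
Proof. by rewrite !mkarr_cast. Qed.

Lemma mkarr_cast_whisker_r (Z A B : sSet) (k : sMap Z A) (g h : sMap A B)
    g' h' (eg : scomp g k = g') (eh : scomp h k = h') (alpha : cell g h) :
  mkarr (cell_cast eg eh (whisker_r alpha k)) =
  mkarr (fhom (ho_map (sexp_pre B k)) alpha).
Proof. by rewrite !mkarr_cast. Qed.

(** The functor [ho_map Phi] preserves composites and identities. Knowing the new cells up to
    [mkarr] suffices, so triangle identities move without handling their casts. *)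
Lemma vcomp_id_transport (A B A' B' : sSet) (Phi : sMap (sexp B A) (sexp B' A'))
    (f g : sMap A B) (f' g' : sMap A' B')
    (alpha : cell f g) (beta : cell g f) (alpha' : cell f' g')
    (beta' : cell g' f') :
  Phi 0 (vertex f) = vertex f' ->
  mkarr (fhom (ho_map Phi) alpha) = mkarr alpha' ->
  mkarr (fhom (ho_map Phi) beta) = mkarr beta' ->
  vcomp beta alpha = cell_id f -> vcomp beta' alpha' = cell_id f'.
Proof.
move=> ef ea eb /(congr1 (fun a => mkarr (fhom (ho_map Phi) a))).
rewrite /vcomp /cell_id (fhom_comp (ho_map Phi)) (fhom_id (ho_map Phi)).
rewrite (mkarr_comp eb ea) => e; apply: mkarr_inj; rewrite e.
exact: (mkarr_id (C := ho (sexp B' A'))).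
Qed.

(** * The covariant exponential on 1-cells and 2-cells *)

Section PostCompositor.
Variable X : sSet.

(** The transpose of the composition map [B^A x A^X -> B^X]. *)
Definition post_compositor (A B : sSet) :
  sMap (sexp B A) (sexp (sexp B X) (sexp A X)).
Proof.
unshelve eexists.
  move=> n g; unshelve eexists.
    move=> m [a q]; unshelve eexists.
      exact: (fun l (p : sprod (Delta m) X l) =>
                g l (simp_comp a p.1, q l p)).
    move=> l' l c [b x] /=; rewrite -smap_nat; congr (g _ _).
    by rewrite /= -smap_nat; congr (_, _); exact: simp_ext.
  move=> m' m c [a q]; apply: smap_ext => l [b x] /=.
  by congr (g _ _).
move=> n' n c g; apply: smap_ext => m [a q]; apply: smap_ext => l [b x] /=.
by congr (g _ _).
Defined.

Lemma post_compositor_vertex (A B : sSet) (g : sMap A B) :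
  post_compositor A B 0 (vertex g) = vertex (sexp_post g X).
Proof. by apply: smap_ext => m [a q]; exact: smap_ext. Qed.

(** Under [ho] this gives compatibility with left whiskering, and [post_compositor_pre] with right
    whiskering. *)
Lemma post_compositor_post (A B C : sSet) (k : sMap B C) :
  scomp (post_compositor A C) (sexp_post k A) =
  scomp (sexp_post (sexp_post k X) (sexp A X)) (post_compositor A B).
Proof.
by apply: smap_ext => n g; apply: smap_ext => m [a q]; exact: smap_ext.
Qed.

Lemma post_compositor_pre (Z A B : sSet) (k : sMap Z A) :
  scomp (post_compositor Z B) (sexp_pre B k) =
  scomp (sexp_pre (sexp B X) (sexp_post k X)) (post_compositor A B).
Proof.
by apply: smap_ext => n g; apply: smap_ext => m [a q]; exact: smap_ext.
Qed.

Lemma sexp_post_id (A : sSet) : sexp_post (sid A) X = sid (sexp A X).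
Proof. by apply: smap_ext => m q; exact: smap_ext. Qed.

Lemma sexp_post_comp (A B C : sSet) (g : sMap B C) (f : sMap A B) :
  sexp_post (scomp g f) X = scomp (sexp_post g X) (sexp_post f X).
Proof. by apply: smap_ext => m q; exact: smap_ext. Qed.

End PostCompositor.

(** * The contravariant exponential on 1-cells and 2-cells *)

Section PreCompositor.
Variable C : sSet.

(** The transpose of the composition map [C^B x B^A -> C^A]. *)
Definition pre_compositor (A B : sSet) :
  sMap (sexp B A) (sexp (sexp C A) (sexp C B)).
Proof.
unshelve eexists.
  move=> n g; unshelve eexists.
    move=> m [a q]; unshelve eexists.
      exact: (fun l (p : sprod (Delta m) A l) =>
                q l (p.1, g l (simp_comp a p.1, p.2))).
    move=> l' l c [b x] /=; rewrite -!smap_nat; congr (q _ _).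
    by congr (_, _); rewrite -smap_nat.
  move=> m' m c [a q]; apply: smap_ext => l [b x] /=.
  by congr (q _ _).
move=> n' n c g; apply: smap_ext => m [a q]; apply: smap_ext => l [b x] /=.
by congr (q _ _).
Defined.

Lemma pre_compositor_vertex (A B : sSet) (g : sMap A B) :
  pre_compositor A B 0 (vertex g) = vertex (sexp_pre C g).
Proof. by apply: smap_ext => m [a q]; exact: smap_ext. Qed.

(** By contravariance, composing with [k] after a map becomes composing with [C^k] before it, so
    left whiskering turns into right whiskering. *)
Lemma pre_compositor_post (A B D : sSet) (k : sMap B D) :
  scomp (pre_compositor A D) (sexp_post k A) =
  scomp (sexp_pre (sexp C A) (sexp_pre C k)) (pre_compositor A B).
Proof.
by apply: smap_ext => n g; apply: smap_ext => m [a q]; exact: smap_ext.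
Qed.

Lemma pre_compositor_pre (Z A B : sSet) (k : sMap Z A) :
  scomp (pre_compositor Z B) (sexp_pre B k) =
  scomp (sexp_post (sexp_pre C k) (sexp C B)) (pre_compositor A B).
Proof.
by apply: smap_ext => n g; apply: smap_ext => m [a q]; exact: smap_ext.
Qed.

Lemma sexp_pre_id (A : sSet) : sexp_pre C (sid A) = sid (sexp C A).
Proof. by apply: smap_ext => m q; apply: smap_ext => l []. Qed.

Lemma sexp_pre_comp (A B D : sSet) (g : sMap B D) (f : sMap A B) :
  sexp_pre C (scomp g f) = scomp (sexp_pre C f) (sexp_pre C g).
Proof. by apply: smap_ext => m q; exact: smap_ext. Qed.

End PreCompositor.

(** * Adjunctions between exponentials *)

(** The unit and counit are the images of [eta] and [eps] under the compositors; as these respect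
    whiskering, each triangle identity is the image of the given one. *)
Lemma sexp_post_adjunction (A B : sSet) (f : sMap B A) (u : sMap A B)
    (X : sSet) :
  qcat_adjunction f u -> qcat_adjunction (sexp_post f X) (sexp_post u X).
Proof.
move=> [qA qB [eta [eps [tl tr]]]]; split; [exact: sexp_qcat..|].
have vert A' B' (g : sMap A' B') g' : sexp_post g X = g' ->
  post_compositor X A' B' 0 (vertex g) = vertex g'.
  by move=> <-; exact: post_compositor_vertex.
exists (cell_map (vert _ _ _ _ (sexp_post_id X B))
                 (vert _ _ _ _ (sexp_post_comp X u f)) eta).
exists (cell_map (vert _ _ _ _ (sexp_post_comp X f u))
                 (vert _ _ _ _ (sexp_post_id X A)) eps).
split.
- apply: vcomp_id_transport tl; first exact: post_compositor_vertex.
    rewrite (mkarr_fhom _ (mkarr_cast_whisker_l _ _ _)) mkarr_cast_whisker_l.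
    rewrite (mkarr_fhom _ (mkarr_cell_map _ _ _)).
    exact/mkarr_ho_map/post_compositor_post.
  rewrite (mkarr_fhom _ (mkarr_cast_whisker_r _ _ _)) mkarr_cast_whisker_r.
  rewrite (mkarr_fhom _ (mkarr_cell_map _ _ _)).
  exact/mkarr_ho_map/post_compositor_pre.
- apply: vcomp_id_transport tr; first exact: post_compositor_vertex.
    rewrite (mkarr_fhom _ (mkarr_cast_whisker_r _ _ _)) mkarr_cast_whisker_r.
    rewrite (mkarr_fhom _ (mkarr_cell_map _ _ _)).
    exact/mkarr_ho_map/post_compositor_pre.
  rewrite (mkarr_fhom _ (mkarr_cast_whisker_l _ _ _)) mkarr_cast_whisker_l.
  rewrite (mkarr_fhom _ (mkarr_cell_map _ _ _)).
  exact/mkarr_ho_map/post_compositor_post.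
Qed.

(* C^(-) reverses 1-cells and preserves 2-cells, so it exchanges the two
   triangle identities. *)
Lemma sexp_pre_adjunction (A B : sSet) (f : sMap B A) (u : sMap A B)
    (C : sSet) :
  is_qcat C ->
  qcat_adjunction f u -> qcat_adjunction (sexp_pre C u) (sexp_pre C f).
Proof.
move=> qC [_ _ [eta [eps [tl tr]]]]; split; [exact: sexp_qcat..|].
have vert A' B' (g : sMap A' B') g' : sexp_pre C g = g' ->
  pre_compositor C A' B' 0 (vertex g) = vertex g'.
  by move=> <-; exact: pre_compositor_vertex.
exists (cell_map (vert _ _ _ _ (sexp_pre_id C B))
                 (vert _ _ _ _ (sexp_pre_comp C u f)) eta).
exists (cell_map (vert _ _ _ _ (sexp_pre_comp C f u))
                 (vert _ _ _ _ (sexp_pre_id C A)) eps).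
split.
- apply: vcomp_id_transport tr; first exact: pre_compositor_vertex.
    rewrite (mkarr_fhom _ (mkarr_cast_whisker_r _ _ _)) mkarr_cast_whisker_l.
    rewrite (mkarr_fhom _ (mkarr_cell_map _ _ _)).
    exact/mkarr_ho_map/pre_compositor_pre.
  rewrite (mkarr_fhom _ (mkarr_cast_whisker_l _ _ _)) mkarr_cast_whisker_r.
  rewrite (mkarr_fhom _ (mkarr_cell_map _ _ _)).
  exact/mkarr_ho_map/pre_compositor_post.
- apply: vcomp_id_transport tl; first exact: pre_compositor_vertex.
    rewrite (mkarr_fhom _ (mkarr_cast_whisker_l _ _ _)) mkarr_cast_whisker_r.
    rewrite (mkarr_fhom _ (mkarr_cell_map _ _ _)).
    exact/mkarr_ho_map/pre_compositor_post.
  rewrite (mkarr_fhom _ (mkarr_cast_whisker_r _ _ _)) mkarr_cast_whisker_l.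
  rewrite (mkarr_fhom _ (mkarr_cell_map _ _ _)).
  exact/mkarr_ho_map/pre_compositor_pre.
Qed.

Theorem proposition4p3p3 (A B : sSet) (f : sMap B A) (u : sMap A B)
  (adj : qcat_adjunction f u) (X C : sSet) (hC : is_qcat C) :
  qcat_adjunction (sexp_post f X) (sexp_post u X) /\
  qcat_adjunction (sexp_pre C u) (sexp_pre C f).
Proof. by split; [exact: sexp_post_adjunction|exact: sexp_pre_adjunction]. Qed.
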